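(* Let $n\ge 1$ and let $x_1,\ldots,x_n$ be non-negative integers. Then $$\sum_{k_1+2k_2+\cdots+nk_n=n}(k_1,\ldots,k_n)!\,x_1^{k_1}\cdots x_n^{k_n}\left(1+\sum_{j=1}^nk_j\right)=\sum_{k_1+2k_2+\cdots+nk_n=n+1}(k_1,\ldots,k_n)!\,x_1^{k_1-1}x_2^{k_2}\cdots x_n^{k_n}\,k_1,$$ where both sums are over $n$-tuples $(k_1,\ldots,k_n)$ of non-negative integers satisfying the indicated condition.
   Context: $(k_1,\ldots,k_n)!$ denotes the multinomial coefficient $\dfrac{(k_1+\cdots+k_n)!}{k_1!\cdots k_n!}$. Terms with $k_1=0$ in the right-hand sum are understood to be $0$ (because of the factor $k_1$), and $0^0=1$. *)

(* Defs.v *)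
From mathcomp Require Import all_boot.
Set Implicit Arguments. Unset Strict Implicit. Unset Printing Implicit Defensive.

(* [%/] is truncated division on nat; it is exact here by [multinomialK]. *)
Definition multinomial (n : nat) (k : 'I_n -> nat) : nat :=
  (\sum_(i < n) k i)`! %/ \prod_(i < n) (k i)`!.

Lemma dvdn_prod_fact (n : nat) (k : 'I_n -> nat) :
  \prod_(i < n) (k i)`! %| (\sum_(i < n) k i)`!.
Proof.
apply: (big_ind2 (fun a b => a %| b`!)) => // a b c d ha hc.
have h := bin_fact (leq_addr d b); rewrite addKn in h.
by rewrite -h dvdn_mull // dvdn_mul.
Qed.

Lemma multinomialK (n : nat) (k : 'I_n -> nat) :
  multinomial k * \prod_(i < n) (k i)`! = (\sum_(i < n) k i)`!.
Proof. by rewrite divnK // dvdn_prod_fact. Qed.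

(* k_1 + 2 k_2 + ... + n k_n, with k_j stored at the ordinal of value j - 1. *)
Definition weight (n : nat) (k : 'I_n -> nat) : nat := \sum_(i < n) i.+1 * k i.

(* Tuples of weight m have all entries at most m, so summing over
   {ffun 'I_n -> 'I_m.+1} ranges over all n-tuples of naturals of weight m. *)
Lemma leq_weight (n m : nat) (k : 'I_n -> nat) :
  weight k = m -> forall i, k i < m.+1.
Proof.
move=> <- i; rewrite ltnS /weight (bigD1 i) //=.
by apply: leq_trans (leq_addr _ _); rewrite leq_pmull.
Qed.

(* Main.v *)
Require Import Defs.
From mathcomp Require Import all_boot.

(** Raising the first entry by one, [k |-> k + e_1], raises the weight by one,
    so it is a bijection from the tuples of weight [n] onto the tuples of
    weight [n + 1] whose first entry is positive; the tuples with [k_1 = 0]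
    contribute nothing to the right-hand sum because of the factor [k_1]. The
    identity then holds term by term: the powers of the [x_i] agree, as the
    exponent of [x_1] is lowered back by one, and the coefficients agree because
    [(k + e_1)! (k_1 + 1) = (k)! (1 + k_1 + ... + k_n)] for multinomial
    coefficients ([multinomial_incr]), both sides being
    [(1 + k_1 + ... + k_n)! / (k_1! ... k_n!)]. *)

Definition incr_at {n : nat} (j : 'I_n) (k : 'I_n -> nat) (i : 'I_n) : nat :=
  k i + (i == j).

Lemma eq_weight {n : nat} {k l : 'I_n -> nat} :
  k =1 l -> weight k = weight l.
Proof. by move=> kl; apply: eq_bigr => i _; rewrite kl. Qed.

Lemma eq_multinomial {n : nat} {k l : 'I_n -> nat} :
  k =1 l -> multinomial k = multinomial l.
Proof.
move=> kl; rewrite /multinomial (eq_bigr l) => [|i _]; last exact: kl.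
by congr (_ %/ _); apply: eq_bigr => i _; rewrite kl.
Qed.

Lemma sum_incr_at (n : nat) (j : 'I_n) (k : 'I_n -> nat) :
  \sum_(i < n) incr_at j k i = (\sum_(i < n) k i).+1.
Proof.
rewrite (bigD1 j) //= [in RHS](bigD1 j) //= /incr_at eqxx addn1 addSn.
by congr (_ + _).+1; apply: eq_bigr => i /negbTE ->; rewrite addn0.
Qed.

Lemma weight_incr_at (n : nat) (j : 'I_n) (k : 'I_n -> nat) :
  weight (incr_at j k) = weight k + j.+1.
Proof.
rewrite /weight (bigD1 j) //= [in RHS](bigD1 j) //= /incr_at eqxx addn1 mulnS.
rewrite (eq_bigr (fun i : 'I_n => i.+1 * k i)).
  by rewrite -addnA addnC.
by move=> i /negbTE ->; rewrite addn0.
Qed.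

Lemma prod_fact_incr_at (n : nat) (j : 'I_n) (k : 'I_n -> nat) :
  \prod_(i < n) (incr_at j k i)`! = (k j).+1 * \prod_(i < n) (k i)`!.
Proof.
rewrite (bigD1 j) //= [in RHS](bigD1 j) //= /incr_at eqxx addn1 factS mulnA.
by congr (_ * _); apply: eq_bigr => i /negbTE ->; rewrite addn0.
Qed.

(** Multiplied by [\prod_i (k i)`!], either side becomes the factorial of
    [1 + \sum_i k i]. *)
Lemma multinomial_incr (n : nat) (j : 'I_n) (k : 'I_n -> nat) :
  multinomial (incr_at j k) * (k j).+1
  = multinomial k * (\sum_(i < n) k i).+1.
Proof.
have fact_gt : 0 < \prod_(i < n) (k i)`!.
  by apply: prodn_gt0 => i; apply: fact_gt0.
apply/eqP; rewrite -(eqn_pmul2r fact_gt) -mulnA -prod_fact_incr_at.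
by rewrite multinomialK sum_incr_at factS mulnAC multinomialK mulnC.
Qed.

Theorem theorem7 (n : nat) (hn : 0 < n) (x : 'I_n -> nat) :
  \sum_(k : {ffun 'I_n -> 'I_n.+1} | weight (fun i => k i) == n)
     multinomial (fun i => k i) * (\prod_(i < n) x i ^ k i)
       * (1 + \sum_(j < n) k j)
  = \sum_(k : {ffun 'I_n -> 'I_n.+2} | weight (fun i => k i) == n.+1)
     multinomial (fun i => k i)
       * (x (Ordinal hn) ^ (k (Ordinal hn) - 1)
          * \prod_(i < n | i != Ordinal hn) x i ^ k i)
       * k (Ordinal hn).
Proof.
set i0 := Ordinal hn.
pose up (k : {ffun 'I_n -> 'I_n.+1}) : {ffun 'I_n -> 'I_n.+2} :=
  [ffun i => inord (incr_at i0 (fun i => k i) i)].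
pose down (k : {ffun 'I_n -> 'I_n.+2}) : {ffun 'I_n -> 'I_n.+1} :=
  [ffun i => inord (k i - (i == i0))].
have upE k : (fun i => up k i : nat) =1 incr_at i0 (fun i => k i).
  move=> i; rewrite ffunE inordK //.
  rewrite ltnS /incr_at; apply: leq_trans (ltn_ord (k i)).
  by rewrite -[X in _ <= X]addn1 leq_add2l leq_b1.
have upK : cancel up down.
  move=> k; apply/ffunP => i; apply: ord_inj.
  by rewrite ffunE (upE k i) /incr_at addnK inord_val.
rewrite [RHS](bigID (fun k : {ffun 'I_n -> 'I_n.+2} => 0 < k i0)) /=.
rewrite [X in _ = _ + X]big1 ?addn0; last first.
  by move=> k /andP[_]; rewrite -eqn0Ngt => /eqP ->; rewrite muln0.
rewrite [RHS](reindex_onto up down) /=; last first.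
  move=> k /andP[/eqP wk k_gt0].
  pose l i := k i - (i == i0).
  have lE : incr_at i0 l =1 (fun i => k i).
    by move=> i; rewrite /incr_at subnK //; case: eqP => // ->.
  (* The decremented tuple has weight n, hence entries at most n: [inord] in
     [down] does not truncate. *)
  have wl : weight l = n.
    by apply/eqP; rewrite -eqSS -wk -(eq_weight lE) weight_incr_at addn1.
  apply/ffunP => i; apply: ord_inj.
  rewrite (upE _ i) -[RHS]lE /incr_at ffunE inordK //.
  exact: (leq_weight wl).
apply: eq_big => [k|k _].
  by rewrite upK eqxx andbT (eq_weight (upE k)) weight_incr_at addn1 eqSS
             (upE k i0) /incr_at eqxx addn1 andbT.
rewrite (eq_multinomial (upE k)) (upE k i0) {2 3}/incr_at eqxx addnK.
rewrite [RHS]mulnAC addn1 multinomial_incr add1n [LHS]mulnAC.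
rewrite [X in _ * X = _](bigD1 i0) //=; congr (_ * (_ * _)).
by apply: eq_bigr => i /negbTE i_neq; rewrite (upE k i) /incr_at i_neq addn0.
Qed.
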